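(* Let $\mathcal{C}_1,\dots,\mathcal{C}_k$ be complexes on a finite set $V$ and let $\mathcal{C}=\bigcap_{i=1}^k\mathcal{C}_i$. For every real $\lambda>0$, the following are equivalent: (1) $\lambda P(\mathcal{C})\supseteq\bigcap_{i=1}^kP(\mathcal{C}_i)$; (2) $\chi^*(\mathcal{C},w)\le\lambda\max_{1\le i\le k}\chi^*(\mathcal{C}_i,w)$ for every $w\in\mathbb{R}^V_{\ge 0}$.
   Context: A complex on a finite set $V$ is a non-empty family of subsets of $V$ closed under taking subsets. The polytope $P(\mathcal{C})\subseteq\mathbb{R}^V_{\ge 0}$ is the convex hull of the characteristic vectors $\mathbf{1}_S$, $S\in\mathcal{C}$, and $\lambda A=\{\lambda a: a\in A\}$. For a complex $\mathcal{C}$ on $V$ and $w\in\mathbb{R}^V_{\ge 0}$, a $w$-fractional coloring of $\mathcal{C}$ is a function $f:\mathcal{C}\to\mathbb{R}_{\ge 0}$ with $\sum_{S\in\mathcal{C}:v\in S}f(S)\ge w(v)$ for every $v\in V$; $\chi^*(\mathcal{C},w)$ is the minimum of $\sum_{S\in\mathcal{C}}f(S)$ over all $w$-fractional colorings $f$ (with the convention that it is $\infty$ if there are none). *)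

(* Defs.v *)
From HB Require Import structures.
From mathcomp Require Import all_boot all_order all_algebra.
From mathcomp Require Import all_classical all_reals all_analysis.

Set Implicit Arguments.
Unset Strict Implicit.
Unset Printing Implicit Defensive.

Import Order.TTheory GRing.Theory Num.Theory.
Import numFieldNormedType.Exports.

Local Open Scope classical_set_scope.
Local Open Scope ring_scope.

Definition is_complex (V : finType) (C : {set {set V}}) : Prop :=
  C != finset.set0 /\
  forall S T : {set V}, S \in C -> T \subset S -> T \in C.

Definition convex_hull (R : numDomainType) (E : lmodType R) (A : set E) :
    set E :=
  smallest (@convex_set R E) A.

(* [R^o] makes [{ffun V -> R^o}], i.e. R^V, a module over R. *)
Definition char_vec (R : realType) (V : finType) (S : {set V}) :
    {ffun V -> R^o} :=
  [ffun v => (v \in S)%:R].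

Definition polytope (R : realType) (V : finType) (C : {set {set V}}) :
    set {ffun V -> R^o} :=
  convex_hull [set char_vec R S | S in [set` C]].

Arguments char_vec R {V} S.
Arguments polytope R {V} C.

Definition dilate (R : numDomainType) (E : lmodType R) (lambda : R)
    (A : set E) : set E :=
  [set lambda *: a | a in A].

(* A function on C is represented by a function on all subsets of V, whose
   values outside C are irrelevant. *)
Definition is_fractional_coloring (R : realType) (V : finType)
    (C : {set {set V}}) (w : V -> R) (f : {set V} -> R) : Prop :=
  (forall S, S \in C -> 0 <= f S) /\
  (forall v, w v <= \sum_(S in C | v \in S) f S).

(* The infimum of the empty set is +oo; otherwise the infimum is a minimum,
   by [chi_star_min] below. *)
Definition chi_star (R : realType) (V : finType) (C : {set {set V}})
    (w : V -> R) : \bar R :=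
  ereal_inf [set (\sum_(S in C) f S)%:E | f in is_fractional_coloring C w].

Lemma polytopeP (R : realType) (V : finType) (C : {set {set V}})
    (x : {ffun V -> R^o}) :
  polytope R C x <->
  exists a : {set V} -> R,
    [/\ (forall S, S \in C -> 0 <= a S), \sum_(S in C) a S = 1 &
        x = \sum_(S in C) a S *: char_vec R S].
Proof.
split.
- pose K := [set x : {ffun V -> R^o} | exists a : {set V} -> R,
    [/\ (forall S, S \in C -> 0 <= a S), \sum_(S in C) a S = 1 &
        x = \sum_(S in C) a S *: char_vec R S]].
  suff: polytope R C `<=` K by apply.
  apply: smallest_sub.
    move=> y z t /set_mem[a [a0 a1 ->]] /set_mem[b [b0 b1 ->]].
    apply/mem_set; exists (fun S => t%:num * a S + (1 - t%:num) * b S); split.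
    + move=> S SC; apply: addr_ge0; apply: mulr_ge0; rewrite ?subr_ge0 //;
        [exact: a0|exact: b0].
    + by rewrite big_split /= -!mulr_sumr a1 b1 !mulr1 addrC subrK.
    + rewrite /conv /= !scaler_sumr -big_split /=.
      by apply: eq_bigr => S _; rewrite [RHS]scalerDl !scalerA.
  move=> _ [S /= SC <-]; exists (fun T => (T == S)%:R); split.
  + by move=> T _; exact: ler0n.
  + rewrite (bigD1 S) //= eqxx big1 ?addr0 // => T /andP[_ /negbTE ->] //.
  + rewrite (bigD1 S) //= eqxx scale1r big1 ?addr0 // => T /andP[_ /negbTE ->].
    by rewrite scale0r.
- move=> [a [a0 a1 ->]] K [cK CK].
  have H (r : seq {set V}) (b : {set V} -> R) : {subset r <= C} ->
      (forall S, S \in r -> 0 <= b S) -> \sum_(S <- r) b S = 1 ->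
      K (\sum_(S <- r) b S *: char_vec R S).
    elim: r b => [|S r IH] b rC b0.
      by rewrite big_nil => /esym/eqP; rewrite oner_eq0.
    rewrite !big_cons => b1.
    have KS : K (char_vec R S) by apply: CK; exists S => //; apply: rC; rewrite mem_head.
    set s := \sum_(T <- r) b T in b1 *.
    have br T : T \in r -> 0 <= b T by move=> Tr; apply: b0; rewrite inE Tr orbT.
    have s0 : 0 <= s by rewrite /s big_seq; apply: sumr_ge0.
    have bS0 : 0 <= b S by apply: b0; rewrite mem_head.
    have bS1 : b S <= 1 by rewrite -b1 lerDl.
    have [sE|sN] := eqVneq s 0.
      have bz T : T \in r -> b T = 0.
        move=> Tr; move/eqP: sE; rewrite /s big_seq psumr_eq0 //.
        by move=> /allP/(_ T Tr); rewrite Tr => /eqP.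
      rewrite big_seq big1 ?addr0; last by move=> T Tr; rewrite bz // scale0r.
      by move: b1; rewrite sE addr0 => ->; rewrite scale1r.
    have KT : K (\sum_(T <- r) (b T / s) *: char_vec R T).
      apply: IH.
      + by move=> T Tr; apply: rC; rewrite inE Tr orbT.
      + by move=> T Tr; rewrite divr_ge0 ?br.
      + by rewrite -mulr_suml divff.
    pose t : {i01 R} := Itv01 bS0 bS1.
    have := cK _ _ t (mem_set KS) (mem_set KT).
    move=> /set_mem; congr K.
    rewrite /conv /=; congr (_ + _).
    have -> : unstable.onem (b S) = s by rewrite /unstable.onem -b1 addrC addKr.
    rewrite scaler_sumr; apply: eq_bigr => T _.
    by rewrite scalerA mulrC divfK.
  rewrite -big_enum.
  by apply: H; rewrite ?big_enum // => S; rewrite mem_enum //; exact: a0.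
Qed.

Lemma chi_star_min (R : realType) (V : finType) (C : {set {set V}})
    (w : V -> R) :
  (exists f, is_fractional_coloring C w f) ->
  exists f, [/\ is_fractional_coloring C w f,
    chi_star C w = (\sum_(S in C) f S)%:E &
    forall g, is_fractional_coloring C w g ->
      \sum_(S in C) f S <= \sum_(S in C) g S].
Proof.
move=> [f0 [f0_ge0 f0w]].
pose M := \sum_(S in C) f0 S.
pose X := prod_topology (fun _ : {set V} => R : topologicalType).
have sumc (P : pred {set V}) : continuous (fun f : X => \sum_(S | P S) f S : R).
  apply: continuous_big; first exact: add_continuous.
  move=> S _; exact: (@proj_continuous _ (fun _ : {set V} => R) S).
pose B : set X := [set f | forall S, [set` `[0, M]] (f S)].
pose D : set X := \bigcap_(v in [set: V])
  ((fun f : X => \sum_(S in C | v \in S) f S : R) @^-1` [set y | w v <= y]).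
have cK : compact (B `&` D).
  apply: compact_closedI.
    have := @tychonoff {set V} (fun=> R : topologicalType) (fun=> [set` `[0, M]]).
    by apply=> _; exact: segment_compact.
  apply: closed_bigI => v _; apply: preimage_closed; last exact: closed_ge.
  by move=> f _; exact: sumc.
have trunc g : is_fractional_coloring C w g -> \sum_(S in C) g S <= M ->
    (B `&` D) (fun S => if S \in C then g S else 0).
  move=> [g0 gw] gM; split.
    move=> S /=; rewrite in_itv /=; case: ifPn => SC.
      rewrite g0 //=; apply: le_trans gM; rewrite (bigD1 S) //= lerDl.
      by apply: sumr_ge0 => T /andP[TC _]; exact: g0.
    by rewrite lexx /=; apply: sumr_ge0 => T TC; exact: f0_ge0.
  move=> v _ /=; rewrite (eq_bigr g) //.
  by move=> S /andP[-> _].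
have K0 : (B `&` D) !=set0.
  by exists (fun S => if S \in C then f0 S else 0); apply: trunc.
have [f /set_mem[fB fD] fmin] := compact_EVT_min K0 cK
  (continuous_subspaceT (sumc (fun S => S \in C))).
have ff : is_fractional_coloring C w f.
  split; last by move=> v; exact: (fD v).
  by move=> S _; move: (fB S); rewrite /= in_itv /= => /andP[].
have fle g : is_fractional_coloring C w g ->
    \sum_(S in C) g S <= M -> \sum_(S in C) f S <= \sum_(S in C) g S.
  move=> gg gM; have := fmin _ (mem_set (trunc _ gg gM)).
  by under [leRHS]eq_bigr => S SC do rewrite SC.
have fM g : is_fractional_coloring C w g ->
    \sum_(S in C) f S <= \sum_(S in C) g S.
  move=> gg; have [|/ltW Mg] := leP (\sum_(S in C) g S) M; first exact: fle.
  by apply: le_trans Mg; exact: fle.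
exists f; split => //; apply/eqP; rewrite eq_le; apply/andP; split.
  by apply: ereal_inf_lbound; exists f.
by apply: le_ereal_inf_tmp => _ [g gg <-]; rewrite lee_fin; exact: fM.
Qed.

(* Main.v *)
Require Import Defs.
From HB Require Import structures.
From mathcomp Require Import all_boot all_order all_algebra.
From mathcomp Require Import all_classical all_reals all_analysis.

Set Implicit Arguments.
Unset Strict Implicit.
Unset Printing Implicit Defensive.

Import Order.TTheory GRing.Theory Num.Theory.
Import numFieldNormedType.Exports.

Local Open Scope classical_set_scope.
Local Open Scope ring_scope.

(** For a complex [D] and [mu > 0], a nonnegative vector [x] lies in [mu P(D)]
    if and only if [chi_star D x <= mu] ([dilate_polytopeP]).  Both directions
    of the theorem follow.  If (2) holds and [x] is in every [P(C_i)], then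
    every [chi_star (C_i) x] is at most [1], so [chi_star C x <= lambda], which
    says that [x] is in [lambda P(C)].  If (1) holds and the maximum of the
    [chi_star (C_i) w] is at most a real [m > 0], then [w / m] is in every
    [P(C_i)], hence in [lambda P(C)], and so [chi_star C w <= lambda m]; letting
    [m] decrease to the maximum also covers the case where the maximum is [0].

    In the equivalence, a point of [mu P(D)] is [mu] times a convex combination
    of characteristic vectors, and its coefficients form a fractional coloring
    of total weight [mu].  Conversely, a coloring of total weight at most [mu],
    completed to weight exactly [mu] on the empty set, gives a point of
    [mu P(D)] which is only known to dominate [x].  Hence the main step is that
    [P(D)] is closed under decreasing coordinates within the nonnegative orthant
    ([polytope_down]).  It suffices to decrease one coordinate at a time, and
    scaling the coordinate [v] by [t] in [0, 1] is a linear map sending the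
    vertex [1_S] to a point of the segment from [1_(S :\ v)] to [1_S]. *)

Lemma dilateP (R : numFieldType) (E : lmodType R) (mu : R) (A : set E) (x : E) :
  mu != 0 -> dilate mu A x <-> A (mu^-1 *: x).
Proof.
move=> mu0; split=> [[a Aa <-]|Ax]; first by rewrite scalerK.
by exists (mu^-1 *: x); rewrite ?scalerKV.
Qed.

Lemma complex_set0 (V : finType) (D : {set {set V}}) :
  is_complex D -> finset.set0 \in D.
Proof. by move=> [/set0Pn[S SD] down]; apply: down SD (finset.sub0set S). Qed.

Lemma complex_bigcap (V : finType) (k : nat) (C : 'I_k -> {set {set V}}) :
  (forall i, is_complex (C i)) -> is_complex (\bigcap_(i < k) C i)%SET.
Proof.
move=> hC; split.
  apply/set0Pn; exists finset.set0; apply/finset.bigcapP => i _.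
  exact: complex_set0.
move=> S T /finset.bigcapP SC TS; apply/finset.bigcapP => i _.
by apply: (hC i).2 TS; exact: SC.
Qed.

Section Polytope.
Context (R : realType) (V : finType).
Implicit Types (D : {set {set V}}) (x y : {ffun V -> R^o}) (S : {set V}).

Lemma polytope_char_vec D S : S \in D -> polytope R D (char_vec R S).
Proof. by move=> SD K [_]; apply; exists S. Qed.

Lemma polytope_convex D : convex_set (polytope R D).
Proof.
move=> x y t /set_mem Px /set_mem Py; apply/mem_set => K KD.
by apply/set_mem/(KD.1); apply/mem_set; [exact: Px|exact: Py].
Qed.

Lemma sum_char_vecE D (a : {set V} -> R) (v : V) :
  (\sum_(S in D) a S *: char_vec R S) v = \sum_(S in D | v \in S) a S.
Proof.
rewrite sum_ffunE big_mkcondr /=; apply: eq_bigr => S _.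
by rewrite !ffunE; case: (v \in S); [exact: mulr1|exact: mulr0].
Qed.

Definition scale_coord (v : V) (t : R) x : {ffun V -> R^o} :=
  [ffun u => if u == v then t * x u else x u].

(** At a vertex [1_S] the image is [t 1_S + (1 - t) 1_(S :\ v)], which lies in
    the polytope because [S :\ v] belongs to the complex. *)
Lemma polytope_scale_coord D (v : V) (t : R) x :
  is_complex D -> 0 <= t <= 1 -> polytope R D x ->
  polytope R D (scale_coord v t x).
Proof.
move=> [_ down] /andP[t0 t1].
(* The set of points whose image lies in the polytope is convex because scaling
   a coordinate is linear, so it suffices to look at the vertices. *)
suff : polytope R D `<=` [set x | polytope R D (scale_coord v t x)] by apply.
apply: smallest_sub => [y z s /set_mem Py /set_mem Pz|_ [S /= SD <-]].
  apply/mem_set => /=.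
  have := polytope_convex s (mem_set Py) (mem_set Pz).
  move=> /set_mem; congr (polytope R D _).
  apply/ffunP => u; rewrite /conv /= !ffunE.
  case: eqP => // _; rewrite /GRing.scale /= mulrDr; congr (_ + _);
    exact: mulrCA.
have := polytope_convex (Itv01 t0 t1) (mem_set (polytope_char_vec SD))
  (mem_set (polytope_char_vec (down _ (S :\ v)%SET SD (finset.subD1set S v)))).
move=> /set_mem; congr (polytope R D _).
apply/ffunP => u; rewrite /conv /= !ffunE in_setD1.
rewrite /GRing.scale /= /unstable.onem.
case: eqP => _ /=; first by rewrite mulr0 addr0.
by rewrite -mulrDl addrC subrK mul1r.
Qed.

(** This is what turns the inequalities [>= w v] of a fractional coloring into
    the equalities of a convex combination. *)
Lemma polytope_down D x y : is_complex D ->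
  polytope R D x -> (forall v, 0 <= y v <= x v) -> polytope R D y.
Proof.
move=> cD Px yx.
(* Coordinates are lowered from [x] to [y] along a list of elements of
   [V]. *)
pose z (r : seq V) : {ffun V -> R^o} := [ffun u => if u \in r then y u else x u].
suff Pz r : polytope R D (z r).
  have -> : y = z (enum V) by apply/ffunP => u; rewrite ffunE mem_enum.
  exact: Pz.
elim: r => [|v r IH].
  by have -> : z [::] = x by apply/ffunP => u; rewrite ffunE.
have /andP[y0 yz] : 0 <= y v <= z r v.
  rewrite ffunE; case: ifP => // _; have /andP[-> _] := yx v; exact: lexx.
have z0 := le_trans y0 yz.
have -> : z (v :: r) = scale_coord v (y v / z r v) (z r).
  apply/ffunP => u; rewrite [LHS]ffunE [RHS]ffunE inE.
  case: eqP => [->|_] /=; last by rewrite ffunE.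
  (* If [z r v = 0] then [y v = 0] and the ratio is [0 / 0 = 0]. *)
  have [zr0|zr0] := eqVneq (z r v) 0; last by rewrite divfK.
  by rewrite zr0 mulr0; apply/le_anti; rewrite y0 -zr0 yz.
apply: polytope_scale_coord => //; rewrite divr_ge0 //=.
have [->|zr0] := eqVneq (z r v) 0; first by rewrite invr0 mulr0 ler01.
by rewrite ler_pdivrMr ?mul1r // lt_neqAle eq_sym zr0.
Qed.

Lemma chi_star_ge0 D (w : V -> R) : (0 <= chi_star D w)%E.
Proof.
apply: le_ereal_inf_tmp => _ [f [f0 _] <-].
by rewrite lee_fin; apply: sumr_ge0.
Qed.

(** The coefficients of a convex combination, multiplied by [mu], are a coloring
    of weight [mu]; conversely an optimal coloring, divided by [mu] and filled up
    to weight [1], is a point of the polytope above [x / mu]. *)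
Lemma dilate_polytopeP D (mu : R) x : is_complex D -> 0 < mu ->
  dilate mu (polytope R D) x <->
  (forall v, 0 <= x v) /\ (chi_star D x <= mu%:E)%E.
Proof.
move=> cD mu0; split=> [[_ /polytopeP[a [a0 a1 ->]] <-]|[x0 chi_mu]].
  have xE v : (mu *: (\sum_(S in D) a S *: char_vec R S) : {ffun V -> R^o}) v
      = \sum_(S in D | v \in S) mu * a S.
    by rewrite ffunE sum_char_vecE -mulr_sumr.
  have ma0 S : S \in D -> 0 <= mu * a S.
    by move=> SD; rewrite mulr_ge0 ?a0 // ltW.
  split=> [v|]; first by rewrite xE; apply: sumr_ge0 => S /andP[SD _]; exact: ma0.
  apply: ereal_inf_lbound; exists (fun S => mu * a S).
    by split=> // v; rewrite xE.
  by rewrite -mulr_sumr a1 mulr1.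
apply/dilateP; first exact: lt0r_neq0.
have /chi_star_min[f [[f0 fx] chiE _]] :
    exists f, is_fractional_coloring D x f.
  apply: contrapT => nof; move: chi_mu.
  rewrite /chi_star (_ : [set _ | _ in _] = set0) ?ereal_inf0 //.
  by rewrite -subset0 => y [f fP _]; apply: nof; exists f.
move: chi_mu; rewrite chiE lee_fin; set s := \sum_(S in D) f S => s_mu.
have D0 := complex_set0 cD.
(* The missing weight [mu - s] is put on the empty set, which covers nothing. *)
pose b S := (S == finset.set0)%:R * (mu - s).
have b0 S : 0 <= b S by rewrite mulr_ge0 ?subr_ge0.
pose a S := mu^-1 * (f S + b S).
apply: (@polytope_down D (\sum_(S in D) a S *: char_vec R S)) => //.
  apply/polytopeP; exists a; split=> // [S SD|].
    by rewrite mulr_ge0 ?invr_ge0 ?(ltW mu0) // addr_ge0 ?f0.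
  rewrite -mulr_sumr big_split /= -/s (bigD1 finset.set0) //= big1.
    by rewrite addr0 /b eqxx mul1r addrC subrK mulVf // lt0r_neq0.
  by move=> S /andP[_ /negbTE S0]; rewrite /b S0 mul0r.
move=> v; rewrite sum_char_vecE ffunE -mulr_sumr.
rewrite [_ *: _]/(_ * _) mulr_ge0 ?invr_ge0 ?(ltW mu0) //=.
rewrite ler_pM2l ?invr_gt0 //; apply: le_trans (fx v) _.
by apply: ler_sum => S _; rewrite lerDl.
Qed.

End Polytope.

Theorem corollary8p4 (R : realType) (V : finType) (k : nat)
    (C : 'I_k -> {set {set V}}) (lambda : R)
    (hk : (0 < k)%N) (hC : forall i, is_complex (C i)) (hlambda : 0 < lambda) :
  (\bigcap_(i in [set: 'I_k]) polytope R (C i)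
     `<=` dilate lambda (polytope R (\bigcap_(i < k) C i)%SET))
  <->
  (forall w : V -> R, (forall v, 0 <= w v) ->
     (chi_star (\bigcap_(i < k) C i)%SET w
        <= lambda%:E * \big[maxe/-oo]_(i < k) chi_star (C i) w)%E).
Proof.
have cC := complex_bigcap hC.
have lambda_neq0 := lt0r_neq0 hlambda.
split=> [sub w w0|chi_le x Px]; last first.
  have Pxi i : (forall v, 0 <= x v) /\ (chi_star (C i) x <= 1%:E)%E.
    apply/dilate_polytopeP => //; apply/dilateP; first exact: oner_neq0.
    by rewrite invr1 scale1r; exact: Px.
  have x0 := (Pxi (Ordinal hk)).1.
  apply/dilate_polytopeP => //; split=> //.
  apply: le_trans (chi_le x x0) _.
  rewrite -[leRHS]mule1; apply: lee_wpmul2l; first by rewrite lee_fin ltW.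
  by apply/bigmax_leP; split=> [|i _]; [exact: leNye|have [] := Pxi i].
set m := \big[maxe/-oo%E]_(i < k) _.
have chi_m i : (chi_star (C i) w <= m)%E
  by rewrite /m; exact: (le_bigmax _ (fun j => chi_star (C j) w)).
have : (0 <= m)%E := le_trans (chi_star_ge0 _ _) (chi_m (Ordinal hk)).
case: m chi_m => [r chi_r|_ _|//]; last by rewrite gt0_muley ?lte_fin // leey.
rewrite lee_fin => r0; apply/lee_addgt0Pr => e e0.
(* A bound above [r] is positive even if [r = 0], so [w] can be divided by it;
   this choice gives [lambda * m = lambda * r + e]. *)
pose m := r + e / lambda.
have m0 : 0 < m by rewrite ltr_wpDl ?divr_gt0.
pose x : {ffun V -> R^o} := [ffun v => w v].
have wE : w = x by apply/funext => v; rewrite ffunE.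
have x0 v : 0 <= x v by rewrite ffunE.
have : dilate lambda (polytope R (\bigcap_(i < k) C i)%SET) (m^-1 *: x).
  apply: sub => i _; apply/dilateP; first exact: lt0r_neq0.
  apply/dilate_polytopeP => //; split=> //; rewrite -wE.
  by apply: le_trans (chi_r i) _; rewrite lee_fin lerDl divr_ge0 // ltW.
move=> /(dilateP _ _ lambda_neq0); rewrite scalerA -invfM.
have lm0 : 0 < lambda * m by rewrite mulr_gt0.
move=> /(dilateP _ _ (lt0r_neq0 lm0)) /(dilate_polytopeP _ cC lm0)[_].
by rewrite -wE -EFinM -EFinD /m mulrDr [lambda * (_ / _)]mulrC divfK.
Qed.
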